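(* Let $1\le j\le k<n$ be integers. For every voter distribution $P$ on the $j$-element subsets of $[n]$, there exists a committee $\widehat C$ (a $k$-element subset of $[n]$) whose approval proportion satisfies $$\pi_P(\widehat C)\ \ge\ \frac{\binom{k}{j}}{\binom{n}{j}}.$$
   Context: Candidates are identified with $[n]=\{1,2,\dots,n\}$. A list is a $j$-element subset of $[n]$ (unordered). A committee is a $k$-element subset of $[n]$. A voter distribution $P$ is a probability distribution on the set of all lists; $P(\ell)$ is the fraction of voters who submitted list $\ell$. The approval proportion of a committee $C$ with respect to $P$ is $$\pi_P(C)=\sum_{\ell\subseteq C,\ |\ell|=j}P(\ell).$$ *)

(* Defs.v *)
From mathcomp Require Import all_boot all_order all_algebra.

Set Implicit Arguments.
Unset Strict Implicit.
Unset Printing Implicit Defensive.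

Import Order.TTheory GRing.Theory Num.Theory.

Local Open Scope ring_scope.

(* The n candidates are labelled 0, ..., n-1 rather than 1, ..., n. *)
Definition ksubset (n m : nat) := {A : {set 'I_n} | #|A| == m}.

Definition voter_distribution (R : realFieldType) (n j : nat)
    (P : ksubset n j -> R) : Prop :=
  (forall l, 0 <= P l) /\ \sum_(l : ksubset n j) P l = 1.

Definition approval (R : realFieldType) (n j k : nat)
    (P : ksubset n j -> R) (C : ksubset n k) : R :=
  \sum_(l : ksubset n j | val l \subset val C) P l.

(* Main.v *)
Require Import Defs.
From mathcomp Require Import all_boot all_order all_algebra.

Set Implicit Arguments.
Unset Strict Implicit.
Unset Printing Implicit Defensive.

Import Order.TTheory GRing.Theory Num.Theory.

Local Open Scope ring_scope.

(** A committee drawn uniformly at random contains a given list with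
    probability ['C(k, j) / 'C(n, j)], whichever list it is.  By linearity the
    average approval proportion over all committees is therefore exactly this
    ratio, so some committee reaches at least the average.

    The averaging is carried out as a double count: every list lies in the same
    number of committees ([card_ksubset_above]), so exchanging the two sums
    evaluates the total approval over all committees ([sum_approval]); the
    binomial identity [mul_bin_subset] turns the total into an average. *)

Lemma card_ksubset n k : #|{: ksubset n k}| = 'C(n, k).
Proof.
rewrite /ksubset card_sig -[in RHS](card_ord n) -card_draws.
by apply: eq_card => A; rewrite !inE.
Qed.

(** Complementation sends the [k]-sets containing [B] to the [(n - k)]-sets
    disjoint from [B], that is, included in [~: B]. *)
Lemma card_ksubset_above n k (B : {set 'I_n}) : (k <= n)%N ->
  #|[set C : ksubset n k | B \subset val C]| = 'C(n - #|B|, n - k).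
Proof.
move=> le_kn.
have compl_inj : injective (fun C : ksubset n k => ~: val C).
  by move=> C D /setC_inj /val_inj.
rewrite -(card_imset _ compl_inj).
have -> : (n - #|B|)%N = #|~: B| by rewrite [RHS]cardsCs setCK card_ord.
rewrite -cards_draws; apply: eq_card => A; apply/imsetP/idP => [[C]|].
  rewrite !inE => sBC ->; rewrite setCS sBC /=.
  by rewrite cardsCs setCK card_ord (eqP (valP C)).
rewrite !inE => /andP[sAB /eqP cardA].
have cardCA : #|~: A| == k by rewrite cardsCs setCK card_ord cardA subKn.
exists (Sub (~: A) cardCA : ksubset n k); last by rewrite SubK setCK.
by rewrite inE SubK -setCS setCK.
Qed.

(** Both sides equal [n! / (j! (k - j)! (n - k)!)], the number of pairs of a
    [j]-set inside a [k]-set. *)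
Lemma mul_bin_subset n k j : (j <= k)%N -> (k <= n)%N ->
  ('C(n, k) * 'C(k, j) = 'C(n, j) * 'C(n - j, n - k))%N.
Proof.
move=> le_jk le_kn; have le_jn := leq_trans le_jk le_kn.
have le_nk_nj : (n - k <= n - j)%N by rewrite leq_sub2l.
apply/eqP; rewrite -(@eqn_pmul2r (j`! * (k - j)`! * (n - k)`!)); last first.
  by rewrite !muln_gt0 !fact_gt0.
apply/eqP; transitivity n`!.
  by rewrite -(bin_fact le_kn) -(bin_fact le_jk) -!mulnA.
have nk_fact := bin_fact le_nk_nj.
have diff : (n - j - (n - k) = k - j)%N by rewrite subnAC subKn.
rewrite diff in nk_fact.
rewrite -(bin_fact le_jn) -nk_fact -!mulnA; congr (_ * _)%N.
by rewrite [RHS]mulnCA [((k - j)`! * _)%N]mulnC.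
Qed.

Lemma sum_approval (R : realFieldType) n j k (P : ksubset n j -> R) :
  (k <= n)%N ->
  \sum_(C : ksubset n k) approval P C
    = ('C(n - j, n - k))%:R * \sum_(l : ksubset n j) P l.
Proof.
move=> le_kn; rewrite /approval.
rewrite (exchange_big_dep predT) //= mulr_sumr; apply: eq_bigr => l _.
rewrite sumr_const mulr_natl; congr (_ *+ _).
have := card_ksubset_above (val l) le_kn; rewrite (eqP (valP l)) => <-.
by apply: eq_card => C; rewrite !inE.
Qed.

Theorem theorem2p2 (R : realFieldType) (n j k : nat)
  (j_ge1 : (1 <= j)%N) (le_jk : (j <= k)%N) (lt_kn : (k < n)%N)
  (P : ksubset n j -> R) (P_dist : voter_distribution P) :
  exists C : ksubset n k,
    approval P C >= ('C(k, j))%:R / ('C(n, j))%:R.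
Proof.
have le_kn := ltnW lt_kn; have le_jn := leq_trans le_jk le_kn.
set t := _ / _; apply/existsP; apply: contraT => /existsPn small.
have [C0 _] : exists C : ksubset n k, C \in predT.
  by apply/card_gt0P; rewrite card_ksubset bin_gt0.
have lt_total : \sum_(C : ksubset n k) approval P C < \sum_(C : ksubset n k) t.
  apply: ltr_sum => [|C _]; last by rewrite ltNge small.
  by apply/hasP; exists C0; rewrite ?mem_index_enum.
have binR_neq0 : ('C(n, j))%:R != 0 :> R by rewrite pnatr_eq0 -lt0n bin_gt0.
move: lt_total; rewrite sum_approval // P_dist.2 mulr1 sumr_const card_ksubset.
rewrite -[ltRHS]mulr_natl /t mulrA -natrM mul_bin_subset // natrM mulrAC.
by rewrite divff // mul1r ltxx.
Qed.
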